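(* Let $\mathcal{T}_h$ be a simplicial physical mesh and $\mathcal{T}_{c,h}$ the corresponding simplicial computational mesh in $\mathbb{R}^d$, with non-degenerate elements, and let $I_h(\boldsymbol{\xi}_1,\dots,\boldsymbol{\xi}_{N_v})=\sum_{K\in\mathcal{T}_h}|K|\,I_K(\boldsymbol{\xi}_0^K,\dots,\boldsymbol{\xi}_d^K)$ be the discretized meshing functional, where $$I_K(\boldsymbol{\xi}_0^K,\dots,\boldsymbol{\xi}_d^K)=G\left(\hat{E}_KE_K^{-1},\ \frac{\det(\hat{E}_K)}{\det(E_K)},\ \mathbb{M}(\boldsymbol{x}_K),\ \boldsymbol{x}_K\right),$$ considered as a function of the computational vertices with the physical mesh fixed. Then for every element $K\in\mathcal{T}_h$, $$\frac{\partial I_K}{\partial[\boldsymbol{\xi}_1^K,\dots,\boldsymbol{\xi}_d^K]}=E_K^{-1}\frac{\partial G}{\partial\mathbb{J}}+\frac{\partial G}{\partial r}\,\frac{\det(\hat{E}_K)}{\det(E_K)}\,\hat{E}_K^{-1},$$ $$\frac{\partial I_K}{\partial\boldsymbol{\xi}_0^K}=-\boldsymbol{e}^T\frac{\partial I_K}{\partial[\boldsymbol{\xi}_1^K,\dots,\boldsymbol{\xi}_d^K]},\qquad \boldsymbol{e}=[1,\dots,1]^T\in\mathbb{R}^d,$$ where $\frac{\partial G}{\partial\mathbb{J}}$ and $\frac{\partial G}{\partial r}$ are evaluated at $\left(\hat{E}_KE_K^{-1},\frac{\det(\hat{E}_K)}{\det(E_K)},\mathbb{M}(\boldsymbol{x}_K),\boldsymbol{x}_K\right)$.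 Moreover, for each $i=1,\dots,N_v$, $$\frac{\partial I_h}{\partial\boldsymbol{\xi}_i}=\sum_{K\in\omega_i}|K|\,\frac{\partial I_K}{\partial\boldsymbol{\xi}_i},$$ where $\omega_i$ is the patch of elements having the $i$-th vertex as a vertex.
   Context: $\Omega,\Omega_c\subset\mathbb{R}^d$ ($d\ge1$) are bounded, simply connected, polygonal/polyhedral domains (physical and computational), and $\mathbb{M}=\mathbb{M}(\boldsymbol{x})$ is a symmetric, uniformly positive definite $d\times d$ matrix-valued function (metric tensor) on $\Omega$. $G=G(\mathbb{J},r,\mathbb{M},\boldsymbol{x})$ is a given smooth real-valued function of a $d\times d$ matrix $\mathbb{J}$, a scalar $r$ (the slot for $\det(\mathbb{J})$), a $d\times d$ matrix $\mathbb{M}$, and a point $\boldsymbol{x}$; $\frac{\partial G}{\partial\mathbb{J}}$ and $\frac{\partial G}{\partial r}$ are the derivatives with respect to the first and second arguments. $\mathcal{T}_h$ and $\mathcal{T}_{c,h}$ are simplicial meshes of $\Omega$ and $\Omega_c$ with the same numbers $N_v$ of vertices and of elements and the same connectivity. The vertices of $\mathcal{T}_{c,h}$ are $\boldsymbol{\xi}_1,\dots,\boldsymbol{\xi}_{N_v}$. An element $K\in\mathcal{T}_h$ with vertices $\boldsymbol{x}_0^K,\dots,\boldsymbol{x}_d^K$ corresponds to an element $K_c\in\mathcal{T}_{c,h}$ with vertices $\boldsymbol{\xi}_0^K,\dots,\boldsymbol{\xi}_d^K$. $|K|$ is the volume of $K$ and $\boldsymbol{x}_K=\frac{1}{d+1}\sum_{k=0}^d\boldsymbol{x}_k^K$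 its center. The edge matrices (columns are edge vectors) are $$E_K=[\boldsymbol{x}_1^K-\boldsymbol{x}_0^K,\dots,\boldsymbol{x}_d^K-\boldsymbol{x}_0^K],\qquad \hat{E}_K=[\boldsymbol{\xi}_1^K-\boldsymbol{\xi}_0^K,\dots,\boldsymbol{\xi}_d^K-\boldsymbol{\xi}_0^K],$$ both invertible; the Jacobian matrix of the affine map $F_K:K_c\to K$ is $F_K'=E_K\hat{E}_K^{-1}$. Convention for scalar-by-matrix derivatives: for a scalar function $f$ of an $m\times n$ matrix $A$, $\frac{\partial f}{\partial A}$ is the $n\times m$ matrix with $\left(\frac{\partial f}{\partial A}\right)_{i,j}=\frac{\partial f}{\partial A_{j,i}}$. In particular the derivative with respect to a column vector is a row vector, and $[\boldsymbol{\xi}_1^K,\dots,\boldsymbol{\xi}_d^K]$ denotes the $d\times d$ matrix with the indicated columns. *)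

(* Defs.v *)
From HB Require Import structures.
From mathcomp Require Import all_boot all_order all_algebra.
From mathcomp Require Import all_classical all_reals all_analysis.

Set Implicit Arguments.
Unset Strict Implicit.
Unset Printing Implicit Defensive.

Import Order.TTheory GRing.Theory Num.Theory.
Import numFieldNormedType.Exports.

Local Open Scope classical_set_scope.
Local Open Scope ring_scope.

Section calculus.
Context {R : realType}.

(* C^k and C^oo regularity on an open set of a finite-dimensional space. *)
Fixpoint Ck_on (V : normedModType R) (U : set V) (k : nat) (f : V -> R) : Prop :=
  match k with
  | 0 => forall p, U p -> {for p, continuous f}
  | k'.+1 => (forall p, U p -> differentiable f p) /\
             (forall v, Ck_on U k' (fun p => 'D_v f p))
  end.

Definition smooth_on (V : normedModType R) (U : set V) (f : V -> R) : Prop :=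
  forall k, Ck_on U k f.

(* Transposed layout: (df/dA)_{i,j} = df/dA_{j,i}, so the derivative with
   respect to a column vector is a row vector. *)
Definition sderiv m n (f : 'M[R]_(m, n) -> R) (A : 'M[R]_(m, n)) : 'M[R]_(n, m) :=
  \matrix_(i, j) 'D_(delta_mx j i) f A.

End calculus.

Section geometry.
Context {R : realType} {d : nat}.
Implicit Types (A Omega : set 'cV[R]_d).

Definition simply_connected A : Prop :=
  let I : set R := [set t | 0 <= t <= 1] in
  (forall p q, A p -> A q -> exists c : R -> 'cV[R]_d,
     [/\ {within I, continuous c}, c 0 = p, c 1 = q &
         forall t, I t -> A (c t)]) /\
  (forall c : R -> 'cV[R]_d,
     {within I, continuous c} -> (forall t, I t -> A (c t)) -> c 0 = c 1 ->
     exists H : R * R -> 'cV[R]_d,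
       [/\ {within I `*` I, continuous H},
           forall p, (I `*` I) p -> A (H p),
           forall t, I t -> H (0, t) = c t,
           forall t, I t -> H (1, t) = c 0 &
           forall s, I s -> H (s, 0) = c 0 /\ H (s, 1) = c 0]).

Definition conv_hull n (p : 'I_n -> 'cV[R]_d) (S : {set 'I_n}) : set 'cV[R]_d :=
  [set y | exists t : 'I_n -> R,
     [/\ forall i, 0 <= t i, forall i, i \notin S -> t i = 0,
         \sum_i t i = 1 & y = \sum_i t i *: p i]].

Definition simplex (p : 'I_d.+1 -> 'cV[R]_d) : set 'cV[R]_d :=
  conv_hull p [set: 'I_d.+1]%SET.

(* A polygonal/polyhedral open set is the interior of a finite union of
   d-simplices. *)
Definition polyhedral Omega : Prop :=
  exists (n : nat) (s : 'I_n -> 'I_d.+1 -> 'cV[R]_d),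
    Omega = (\bigcup_(j in [set: 'I_n]) simplex (s j))°.

Definition polyhedral_domain Omega : Prop :=
  [/\ Omega !=set0, open Omega, bounded_set Omega, simply_connected Omega &
      polyhedral Omega].

(* d-dimensional Lebesgue (outer) measure, from countable covers by boxes. *)
Definition volume A : \bar R :=
  ereal_inf [set s : \bar R | exists a b : nat -> 'cV[R]_d,
    [/\ forall k i, a k i 0 <= b k i 0,
        A `<=` \bigcup_k [set y | forall i, a k i 0 <= y i 0 <= b k i 0] &
        s = (\sum_(0 <= k <oo) (\prod_i (b k i 0 - a k i 0))%:E)%E]].

Definition metric_tensor Omega (M : 'cV[R]_d -> 'M[R]_d) : Prop :=
  (forall p, Omega p -> (M p)^T = M p) /\
  (exists2 c : R, 0 < c & forall p, Omega p -> forall v : 'cV[R]_d,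
     c * (v^T *m v) 0 0 <= (v^T *m M p *m v) 0 0).

End geometry.

Section simplices.
Context {R : realType} {d : nat}.
Implicit Types p q : 'I_d.+1 -> 'cV[R]_d.

(* Columns are the edge vectors p_j - p_0, j = 1, ..., d. *)
Definition edge_mx p : 'M[R]_d :=
  \matrix_(i, j) (p (lift ord0 j) i 0 - p ord0 i 0).

Definition elem_center p : 'cV[R]_d := d.+1%:R^-1 *: \sum_k p k.

(* The matrix [p_1, ..., p_d], and the simplex with first vertex p_0 and the
   other vertices read off the columns of a matrix. *)
Definition vertex_mx p : 'M[R]_d := \matrix_(i, j) p (lift ord0 j) i 0.

Definition with_vertex_mx p (X : 'M[R]_d) : 'I_d.+1 -> 'cV[R]_d :=
  fun k => if unlift ord0 k is Some j then col j X else p ord0.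

End simplices.

Definition with_point (R : realType) d n (p : 'I_n -> 'cV[R]_d) (k : 'I_n)
    (y : 'cV[R]_d) : 'I_n -> 'cV[R]_d :=
  fun l => if l == k then y else p l.

Section meshes.
Context {R : realType} {d Nv Ne : nat}.
(* Connectivity: conn K k is the global number of the k-th vertex of K. *)
Implicit Types (conn : 'I_Ne -> 'I_d.+1 -> 'I_Nv) (x xi : 'I_Nv -> 'cV[R]_d).

Definition elem_vertices conn (K : 'I_Ne) : {set 'I_Nv} :=
  [set conn K k | k : 'I_d.+1]%SET.

Definition elem conn x (K : 'I_Ne) : 'I_d.+1 -> 'cV[R]_d :=
  fun k => x (conn K k).

Definition simplicial_mesh (Omega : set 'cV[R]_d) conn x : Prop :=
  [/\ forall K, edge_mx (elem conn x K) \in unitmx,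
      injective (elem_vertices conn),
      forall i, exists K, i \in elem_vertices conn K,
      closure Omega = \bigcup_(K in [set: 'I_Ne]) simplex (elem conn x K) &
      forall K L, simplex (elem conn x K) `&` simplex (elem conn x L) =
        conv_hull x (elem_vertices conn K :&: elem_vertices conn L)%SET].

Definition vertex_patch conn (i : 'I_Nv) : {set 'I_Ne} :=
  [set K : 'I_Ne | i \in elem_vertices conn K]%SET.

(* Local number of vertex i in K; only meaningful when K is in the patch of i. *)
Definition local_index conn (K : 'I_Ne) (i : 'I_Nv) : 'I_d.+1 :=
  odflt ord0 [pick k | conn K k == i].

End meshes.

Section functional.
Context {R : realType} {d : nat}.
Implicit Types (G : 'M[R]_d -> R -> 'M[R]_d -> 'cV[R]_d -> R)
  (M : 'cV[R]_d -> 'M[R]_d) (p q : 'I_d.+1 -> 'cV[R]_d).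

(* In what follows p are the vertices of a physical element K, and q those of
   the corresponding computational element K_c. *)
Definition Jac p q : 'M[R]_d := edge_mx q *m invmx (edge_mx p).

Definition detJac p q : R := \det (edge_mx q) / \det (edge_mx p).

Definition I_elem G M p q : R :=
  G (Jac p q) (detJac p q) (M (elem_center p)) (elem_center p).

Definition dG_dJ G M p q : 'M[R]_d :=
  sderiv (fun J => G J (detJac p q) (M (elem_center p)) (elem_center p)) (Jac p q).

Definition dG_dr G M p q : R :=
  derive1 (fun r => G (Jac p q) r (M (elem_center p)) (elem_center p))
    (detJac p q).

Definition dI_dvertices G M p q : 'M[R]_d :=
  sderiv (fun X => I_elem G M p (with_vertex_mx q X)) (vertex_mx q).

Definition dI_dvertex G M p q (k : 'I_d.+1) : 'rV[R]_d :=
  sderiv (fun y => I_elem G M p (with_point q k y)) (q k).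

Definition elem_volume p : R := fine (volume (simplex p)).

Definition I_mesh G M Nv Ne (conn : 'I_Ne -> 'I_d.+1 -> 'I_Nv)
    (x xi : 'I_Nv -> 'cV[R]_d) : R :=
  \sum_K elem_volume (elem conn x K) *
         I_elem G M (elem conn x K) (elem conn xi K).

Definition dI_mesh_dvertex G M Nv Ne (conn : 'I_Ne -> 'I_d.+1 -> 'I_Nv)
    (x xi : 'I_Nv -> 'cV[R]_d) (i : 'I_Nv) : 'rV[R]_d :=
  sderiv (fun y => I_mesh G M conn x (with_point xi i y)) (xi i).

End functional.

(* Main.v *)
Require Import Defs.
From HB Require Import structures.
From mathcomp Require Import all_boot all_order perm all_algebra.
From mathcomp Require Import all_classical all_reals all_analysis.

Import Order.TTheory GRing.Theory Num.Theory.
Import numFieldNormedType.Exports.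

Local Open Scope classical_set_scope.
Local Open Scope ring_scope.

Set Implicit Arguments.
Unset Strict Implicit.
Unset Printing Implicit Defensive.

(** The energy of an element depends on the computational vertices only through
    their edge matrix E, as phi(E) = g(E P^-1, det E / det P), where P is the
    edge matrix of the physical element.  The chain rule for phi combines two
    facts: E P^-1 is linear in E, and the derivative of the determinant with
    respect to an entry is the cofactor of that entry ([det_addZ_delta]).
    Since the adjugate of E is det E times E^-1, this gives the formula for d phi / d E ([sderiv_edge_fun]).

    Both derivatives of I_K are pullbacks of d phi / d E by affine maps.  For
    the vertices 1, ..., d the map to the edge matrix is a translation
    ([sderiv_with_vertex]); for the vertex 0 it has linear part v |-> - v e^T
    ([sderiv_with_point0]).

    For the whole mesh, non-degeneracy makes the vertices of an element
    pairwise distinct ([edge_mx_inj]).  A global vertex is thus at most one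
    local vertex of each element, and the derivative of the sum localizes to
    its patch ([sderiv_patch_sum]). *)

(** * Differentiability of matrix expressions *)

Lemma differentiable_bigsum (R : numFieldType) (V W : normedModType R)
    (I : Type) (r : seq I) (F : I -> V -> W) (a : V) :
  (forall i, differentiable (F i) a) ->
  differentiable (fun v => \sum_(i <- r) F i v) a.
Proof.
move=> dF; elim: r => [|i r IH].
  rewrite (_ : (fun _ => _) = cst 0); first exact: differentiable_cst.
  by apply/funext => v; rewrite big_nil.
rewrite (_ : (fun _ => _) = F i + (fun v => \sum_(j <- r) F j v)).
  exact: differentiableD.
by apply/funext => v; rewrite big_cons.
Qed.

Lemma differentiable_bigprod (R : numFieldType) (V : normedModType R)
    (I : Type) (r : seq I) (F : I -> V -> R) (a : V) :
  (forall i, differentiable (F i) a) ->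
  differentiable (fun v => \prod_(i <- r) F i v) a.
Proof.
move=> dF; elim: r => [|i r IH].
  rewrite (_ : (fun _ => _) = cst 1); first exact: differentiable_cst.
  by apply/funext => v; rewrite big_nil.
rewrite (_ : (fun _ => _) = F i * (fun v => \prod_(j <- r) F j v)).
  exact: differentiableM.
by apply/funext => v; rewrite big_cons.
Qed.

(** A matrix-valued map is the finite sum of its entries times the constant
    matrices [delta_mx i j], so its differentiability can be tested entrywise. *)
Lemma differentiable_mx (R : numFieldType) (V : normedModType R) m n
    (f : V -> 'M[R]_(m, n)) (a : V) :
  (forall i j, differentiable (fun v => f v i j) a) -> differentiable f a.
Proof.
move=> df.
rewrite (_ : f = fun v => \sum_i \sum_j f v i j *: delta_mx i j).
  apply: differentiable_bigsum => i; apply: differentiable_bigsum => j.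
  exact/differentiableZl/df.
by apply/funext => v; rewrite -matrix_sum_delta.
Qed.

Lemma differentiable_mulmxr (R : numFieldType) m n k (B : 'M[R]_(n, k))
    (A : 'M[R]_(m, n)) : differentiable (fun X : 'M[R]_(m, n) => X *m B) A.
Proof.
apply: differentiable_mx => i j.
rewrite (_ : (fun _ => _) =
  fun X : 'M[R]_(m, n) => \sum_l (B l j *: (fun X : 'M[R]_(m, n) => X i l)) X).
  apply: differentiable_bigsum => l.
  exact/differentiableZ/differentiable_coord.
by apply/funext => X; rewrite mxE; apply: eq_bigr => l _; rewrite mulrC.
Qed.

(** By the Leibniz formula the determinant is a polynomial in the entries. *)
Lemma differentiable_det (R : numFieldType) n (A : 'M[R]_n) :
  differentiable (@determinant R n) A.
Proof.
rewrite (_ : @determinant R n = fun X : 'M[R]_n => \sum_(s : 'S_n)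
  ((-1) ^+ s *: (fun X : 'M[R]_n => \prod_i X i (s i))) X) //.
apply: differentiable_bigsum => s; apply: differentiableZ.
apply: differentiable_bigprod => i; exact: (@differentiable_coord _ _ _ A i (s i)).
Qed.

(** * Directional derivatives *)

(** When [L] is affine along the line directed by [v], the difference quotients
    of [f o L] along [v] and of [f] along [w] are literally the same function of
    [h], so the two limits agree, whether or not they exist. *)
Lemma derive_comp_affine (R : numFieldType) (V V' W : normedModType R)
    (f : V' -> W) (L : V -> V') (a v : V) (w : V') :
  (forall h, L (h *: v + a) = h *: w + L a) ->
  'D_v (fun y => f (L y)) a = 'D_w f (L a).
Proof.
by move=> Lh; rewrite /derive; under eq_fun do rewrite /= Lh.
Qed.

(** Changing the entry (i, j) of [A] leaves the cofactors of row i unchanged, so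
    the determinant is affine in that entry, with slope the cofactor. *)
Lemma det_addZ_delta (R : comNzRingType) n (A : 'M[R]_n) i j (h : R) :
  \det (h *: delta_mx i j + A) = h * cofactor A i j + \det A.
Proof.
rewrite !(expand_det_row _ i) (bigD1 j) //= [in RHS](bigD1 j) //=.
have cofE k : cofactor (h *: delta_mx i j + A) i k = cofactor A i k.
  congr (_ * \det _); apply/matrixP => a b; rewrite !mxE.
  by rewrite eq_sym (negbTE (neq_lift _ _)) mulr0 add0r.
rewrite addrA cofE !mxE !eqxx mulr1 mulrDl; congr (_ + _).
apply: eq_bigr => k kj; rewrite cofE !mxE (negbTE kj) andbF mulr0 add0r.
by [].
Qed.

Lemma delta_mulmx (R : comNzRingType) m n k (A : 'M[R]_(n, k)) (j : 'I_m) i :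
  delta_mx j i *m A = \sum_l A i l *: delta_mx j l.
Proof.
rewrite {1}(matrix_sum_delta A) mulmx_sumr (bigD1 i) //= [X in _ + X]big1.
  rewrite addr0 mulmx_sumr; apply: eq_bigr => l _.
  by rewrite -scalemxAr mul_delta_mx.
move=> i' i'i; rewrite mulmx_sumr big1 // => l _.
by rewrite -scalemxAr mul_delta_mx_0 ?scaler0 // eq_sym.
Qed.

(** A differential is additive, hence determined by its values on pairs with one
    null component, which are the partial derivatives. *)
Lemma diff_prod_split (R : numFieldType) (V V' W : normedModType R)
    (f : V * V' -> W) (a : V * V') (v : V) (v' : V') :
  differentiable f a ->
  'd f a (v, v') = 'D_v (fun y => f (y, a.2)) a.1
                 + 'D_v' (fun y => f (a.1, y)) a.2.
Proof.
case: a => a a' df /=.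
rewrite (@derive_comp_affine _ _ _ _ f (fun y => (y, a')) _ _ (v, 0)); last first.
  by move=> h; congr pair; rewrite /= scaler0 add0r.
rewrite (@derive_comp_affine _ _ _ _ f (fun y => (a, y)) _ _ (0, v')); last first.
  by move=> h; congr pair; rewrite /= scaler0 add0r.
rewrite !deriveE // -linearD; congr ('d f _ _).
by congr pair; rewrite /= ?addr0 ?add0r.
Qed.

Lemma differentiable_partial1 (R : numFieldType) (V V' W : normedModType R)
    (f : V * V' -> W) (a : V * V') :
  differentiable f a -> differentiable (fun y => f (y, a.2)) a.1.
Proof.
case: a => a a' df /=.
exact: (@differentiable_comp _ _ _ _ (fun y => (y, a')) f).
Qed.

Lemma differentiable_partial2 (R : numFieldType) (V V' W : normedModType R)
    (f : V * V' -> W) (a : V * V') :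
  differentiable f a -> differentiable (fun y => f (a.1, y)) a.2.
Proof.
case: a => a a' df /=.
exact: (@differentiable_comp _ _ _ _ (fun y => (a, y)) f).
Qed.

(** * One element *)

Section element.
Context {R : realType} {d : nat}.
Implicit Types (p q : 'I_d.+1 -> 'cV[R]_d) (E P : 'M[R]_d).

(** With [P] the edge matrix of the physical element, [E] that of the
    computational element, and [g] the function G with its last two arguments
    fixed, this is I_K.  In particular I_K depends on the computational vertices
    only through their edge matrix. *)
Definition edge_fun (g : 'M[R]_d * R -> R) P E : R :=
  g (E *m invmx P, \det E / \det P).

Lemma differentiable_edge_arg P E :
  differentiable (fun E => (E *m invmx P, \det E / \det P)) E.
Proof.
apply: differentiable_pair; first exact: differentiable_mulmxr.
rewrite (_ : (fun _ => _) = (\det P)^-1 *: (@determinant R d)).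
  exact/differentiableZ/differentiable_det.
by apply/funext => X; rewrite /= mulrC.
Qed.

Lemma differentiable_edge_fun g P E :
  differentiable g (E *m invmx P, \det E / \det P) ->
  differentiable (edge_fun g P) E.
Proof.
by move=> dg; apply: (differentiable_comp (differentiable_edge_arg P E) dg).
Qed.

(** Along [delta_mx j i] the inner map E |-> (E P^-1, det E / det P) is affine
    with slope (delta_mx j i P^-1, cofactor E j i / det P).  The first component
    yields row i of P^-1 times column j of dG/dJ.  The second one yields the
    entry (i, j) of the adjugate of E, that is, of det E times E^-1. *)
Lemma sderiv_edge_fun g P E :
  let J := E *m invmx P in let r := \det E / \det P in
  E \in unitmx -> differentiable g (J, r) ->
  sderiv (edge_fun g P) E =
    invmx P *m sderiv (fun J' => g (J', r)) J +
    (derive1 (fun r' => g (J, r')) r * r) *: invmx E.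
Proof.
move=> J r uE dg.
have dJ : differentiable (fun J' => g (J', r)) J.
  exact: (differentiable_partial1 dg).
apply/matrixP => i j; rewrite !mxE.
rewrite /edge_fun (@derive_comp_affine _ _ _ _ g _ _ _
  (delta_mx j i *m invmx P, cofactor E j i / \det P)); last first.
  move=> h; rewrite mulmxDl -scalemxAl det_addZ_delta mulrDl -mulrA.
  by [].
rewrite deriveE //.
rewrite diff_prod_split //=; congr (_ + _).
  rewrite deriveE // (_ : delta_mx j i *m invmx P =
    \sum_k invmx P i k *: delta_mx j k).
    rewrite linear_sum; apply: eq_bigr => k _.
    by rewrite linearZ mxE deriveE.
  exact: delta_mulmx.
have dr : differentiable (fun r' => g (J, r')) r.
  exact: (differentiable_partial2 dg).
rewrite deriveE // diff1E // -[LHS]/(_ * _) mulrC -[RHS]mulrA; congr (_ * _).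
have detE0 : \det E != 0 by rewrite -unitfE -unitmxE.
rewrite /invmx uE mxE [(\adj E) i j]mxE /r [RHS]mulrAC [in RHS]mulrA.
by rewrite mulfV // mul1r.
Qed.

Lemma with_vertex_mxK q : with_vertex_mx q (vertex_mx q) = q.
Proof.
apply/funext => k; rewrite /with_vertex_mx; case: unliftP => [j ->|-> //].
by apply/matrixP => a b; rewrite !mxE ord1.
Qed.

Lemma edge_mx_with_vertexE q (X : 'M[R]_d) i j :
  edge_mx (with_vertex_mx q X) i j = X i j - q ord0 i 0.
Proof. by rewrite mxE /with_vertex_mx liftK unlift_none mxE. Qed.

Lemma differentiable_edge_mx_with_vertex q (X : 'M[R]_d) :
  differentiable (fun Y => edge_mx (with_vertex_mx q Y)) X.
Proof.
apply: differentiable_mx => i j.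
rewrite (_ : (fun _ => _) = (fun Y : 'M[R]_d => Y i j) - cst (q ord0 i 0)).
  by apply: differentiableB; [exact: differentiable_coord|].
by apply/funext => Y; rewrite edge_mx_with_vertexE.
Qed.

Lemma with_pointK n (p : 'I_n -> 'cV[R]_d) k : with_point p k (p k) = p.
Proof. by apply/funext => l; rewrite /with_point; case: eqP => [->|]. Qed.

Lemma differentiable_with_point n (p : 'I_n -> 'cV[R]_d) k l i (y : 'cV[R]_d) :
  differentiable (fun z => with_point p k z l i 0) y.
Proof.
rewrite /with_point; case: (l == k); first exact: differentiable_coord.
exact: differentiable_cst.
Qed.

Lemma differentiable_edge_mx_with_point q k (y : 'cV[R]_d) :
  differentiable (fun z => edge_mx (with_point q k z)) y.
Proof.
apply: differentiable_mx => i j.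
rewrite (_ : (fun _ => _) = (fun z => with_point q k z (lift ord0 j) i 0) -
  (fun z => with_point q k z ord0 i 0)).
  by apply: differentiableB; exact: differentiable_with_point.
by apply/funext => Y; rewrite mxE.
Qed.

(** With the vertex 0 fixed, the edge matrix is a translate of the matrix of the
    other vertices. *)
Lemma sderiv_with_vertex q (phi : 'M[R]_d -> R) :
  sderiv (fun X => phi (edge_mx (with_vertex_mx q X))) (vertex_mx q) =
  sderiv phi (edge_mx q).
Proof.
apply/matrixP => i j; rewrite !mxE -[in RHS](with_vertex_mxK q).
apply: (@derive_comp_affine _ _ _ _ phi
  (fun X => edge_mx (with_vertex_mx q X))) => h.
by apply/matrixP => a b; rewrite [RHS]mxE !edge_mx_with_vertexE !mxE addrA.
Qed.

(** Moving the vertex 0 by [v] subtracts [v] from every column of the edge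
    matrix: the direction [delta_mx j 0] becomes minus the sum of the
    [delta_mx j k], whence the factor - e^T. *)
Lemma sderiv_with_point0 q (phi : 'M[R]_d -> R) :
  differentiable phi (edge_mx q) ->
  sderiv (fun y => phi (edge_mx (with_point q ord0 y))) (q ord0) =
  - ((const_mx 1 : 'cV[R]_d)^T *m sderiv phi (edge_mx q)).
Proof.
move=> dphi; apply/matrixP => i j; rewrite !mxE.
rewrite (@derive_comp_affine _ _ _ _ phi
  (fun y => edge_mx (with_point q ord0 y)) _ _ (- \sum_k delta_mx j k)).
  rewrite with_pointK deriveE // linearN linear_sum; congr (- _).
  by apply: eq_bigr => k _; rewrite !mxE mul1r deriveE.
move=> h; apply/matrixP => a b; rewrite !mxE /with_point /= summxE.
rewrite (bigD1 b) //= big1 ?addr0; last first.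
  by move=> k kb; rewrite mxE [b == k]eq_sym (negbTE kb) andbF.
rewrite !mxE eqxx andbT ord1 eqxx andbT mulrN opprD addrCA; congr (_ + _).
Qed.

(** The edge matrix sends the k-th vertex of the reference simplex (the origin
    for k = 0, the (k-1)-th basis vector otherwise) to [p k - p ord0].  An
    invertible edge matrix therefore separates the vertices. *)
Lemma edge_mx_inj p : edge_mx p \in unitmx -> injective p.
Proof.
move=> up.
(* [b k] is the k-th vertex of the reference simplex. *)
pose b k : 'cV[R]_d := \col_j (k == lift ord0 j)%:R.
have bE k : edge_mx p *m b k = p k - p ord0.
  apply/matrixP => i l; rewrite ord1 !mxE.
  case: (unliftP ord0 k) => [j ->|->]; last first.
    by rewrite subrr big1 // => j _; rewrite !mxE (negbTE (neq_lift _ _)) mulr0.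
  rewrite (bigD1 j) //= big1 ?addr0 ?mxE ?eqxx ?mulr1 // => k' k'j.
  by rewrite !mxE (inj_eq lift_inj) eq_sym (negbTE k'j) mulr0.
move=> k l pkl.
have {pkl} bkl : b k = b l by rewrite -(mulKmx up (b k)) bE pkl -bE mulKmx.
have bjE k' j : (b k' j 0 == 1) = (k' == lift ord0 j).
  by rewrite mxE pnatr_eq1 eqb1.
case: (unliftP ord0 k) bkl => [j ->|->] bkl.
  by have := bjE l j; rewrite -bkl bjE eqxx => /esym/eqP.
case: (unliftP ord0 l) bkl => [j ->|-> //] bkl.
by have := bjE (lift ord0 j) j; rewrite -bkl bjE eqxx => /eqP.
Qed.

End element.

(** * Assembly over the mesh *)

Section mesh.
Context {R : realType} {d Nv Ne : nat}.
Implicit Types (conn : 'I_Ne -> 'I_d.+1 -> 'I_Nv) (xi : 'I_Nv -> 'cV[R]_d).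

Lemma local_indexK conn K i :
  K \in vertex_patch conn i -> conn K (local_index conn K i) = i.
Proof.
rewrite inE => /imsetP[k _ ->]; rewrite /local_index.
by case: pickP => [l /eqP //|/(_ k)]; rewrite eqxx.
Qed.

Lemma elem_with_point_in conn xi i y K :
  injective (conn K) -> K \in vertex_patch conn i ->
  elem conn (with_point xi i y) K =
  with_point (elem conn xi K) (local_index conn K i) y.
Proof.
move=> inj /local_indexK cK; apply/funext => k.
by rewrite /elem /with_point -(inj_eq inj) cK.
Qed.

Lemma elem_with_point_out conn xi i y K :
  K \notin vertex_patch conn i ->
  elem conn (with_point xi i y) K = elem conn xi K.
Proof.
rewrite inE => iK; apply/funext => k; rewrite /elem /with_point.
by case: eqP => // cK; case/negP: iK; rewrite -cK imset_f.
Qed.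

(** The local numbering of each element being injective, moving the global vertex
    i moves exactly one local vertex of every element of the patch of i, and
    leaves the other elements unchanged: their terms are constant. *)
Lemma sderiv_patch_sum conn xi i (w : 'I_Ne -> R)
    (phi : 'I_Ne -> ('I_d.+1 -> 'cV[R]_d) -> R) :
  (forall K, injective (conn K)) ->
  (forall K k, differentiable (fun y => phi K (with_point (elem conn xi K) k y))
                 (elem conn xi K k)) ->
  let f y := \sum_K w K * phi K (elem conn (with_point xi i y) K) in
  differentiable f (xi i) /\
  sderiv f (xi i) = \sum_(K in vertex_patch conn i) w K *:
    sderiv (fun y => phi K (with_point (elem conn xi K) (local_index conn K i) y))
      (elem conn xi K (local_index conn K i)).
Proof.
move=> inj dphi f.
pose g K y := phi K (elem conn (with_point xi i y) K).
have g_in K : K \in vertex_patch conn i ->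
    g K = fun y => phi K (with_point (elem conn xi K) (local_index conn K i) y).
  by move=> iK; apply/funext => y; rewrite /g elem_with_point_in.
have g_out K : K \notin vertex_patch conn i ->
    g K = cst (phi K (elem conn xi K)).
  by move=> iK; apply/funext => y; rewrite /g elem_with_point_out.
have xiE K : K \in vertex_patch conn i ->
    elem conn xi K (local_index conn K i) = xi i.
  by move=> iK; rewrite /elem local_indexK.
have dg K : differentiable (g K) (xi i).
  have [iK|iK] := boolP (K \in vertex_patch conn i).
    by rewrite g_in // -[X in differentiable _ X](xiE K).
  by rewrite g_out //; exact: differentiable_cst.
have -> : f = \sum_K (w K *: g K) by apply/funext => y; rewrite fct_sumE.
have dwg K : differentiable (w K *: g K) (xi i) by exact: differentiableZ.
split; first exact: differentiable_sum.
apply/matrixP => a b; rewrite mxE summxE derive_sum; last first.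
  by move=> K; exact: diff_derivable.
rewrite [RHS]big_mkcond; apply: eq_bigr => K _.
rewrite deriveZ; last exact: diff_derivable.
case: ifPn => iK; last by rewrite g_out // derive_cst scaler0.
by rewrite !mxE g_in // xiE.
Qed.

End mesh.

Theorem mainTheorem1 (R : realType) (d Nv Ne : nat) (d_gt0 : (0 < d)%N)
  (Omega Omega_c : set 'cV[R]_d)
  (Omega_dom : polyhedral_domain Omega)
  (Omega_c_dom : polyhedral_domain Omega_c)
  (M : 'cV[R]_d -> 'M[R]_d) (M_metric : metric_tensor Omega M)
  (conn : 'I_Ne -> 'I_d.+1 -> 'I_Nv) (x xi : 'I_Nv -> 'cV[R]_d)
  (Th_mesh : simplicial_mesh Omega conn x)
  (Tch_mesh : simplicial_mesh Omega_c conn xi)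
  (* U is the (open) domain of smoothness of G. *)
  (G : 'M[R]_d -> R -> 'M[R]_d -> 'cV[R]_d -> R)
  (U : set ('M[R]_d * R * 'M[R]_d * 'cV[R]_d)%type)
  (U_open : open U)
  (G_smooth : smooth_on U (fun a => G a.1.1.1 a.1.1.2 a.1.2 a.2))
  (U_args : forall K : 'I_Ne, let p := elem conn x K in let q := elem conn xi K in
     U (Jac p q, detJac p q, M (elem_center p), elem_center p)) :
  (forall K : 'I_Ne,
     let p := elem conn x K in
     let q := elem conn xi K in
     [/\ differentiable (fun X => I_elem G M p (with_vertex_mx q X)) (vertex_mx q),
         forall k, differentiable (fun y => I_elem G M p (with_point q k y)) (q k),
         dI_dvertices G M p q =
           invmx (edge_mx p) *m dG_dJ G M p q +
           (dG_dr G M p q * (\det (edge_mx q) / \det (edge_mx p))) *: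
             invmx (edge_mx q) &
         dI_dvertex G M p q ord0 =
           - ((const_mx 1 : 'cV[R]_d)^T *m dI_dvertices G M p q)]) /\
  (forall i : 'I_Nv,
     differentiable (fun y => I_mesh G M conn x (with_point xi i y)) (xi i) /\
     dI_mesh_dvertex G M conn x xi i =
       \sum_(K in vertex_patch conn i)
         elem_volume (elem conn x K) *:
           dI_dvertex G M (elem conn x K) (elem conn xi K) (local_index conn K i)).
Proof.
(* G as a function of its first two slots, the last two being fixed by K. *)
pose g K u := G u.1 u.2 (M (elem_center (elem conn x K)))
  (elem_center (elem conn x K)).
have dg K : differentiable (g K : 'M[R]_d * R -> R)
    (Jac (elem conn x K) (elem conn xi K), detJac (elem conn x K) (elem conn xi K)).
  have [dG _] := G_smooth 1.
  have := differentiable_partial1 (differentiable_partial1 (dG _ (U_args K))).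
  exact.
have [ux _ _ _ _] := Th_mesh; have [uxi _ _ _ _] := Tch_mesh.
have dphi K : differentiable (edge_fun (g K) (edge_mx (elem conn x K)))
    (edge_mx (elem conn xi K)).
  exact/differentiable_edge_fun/dg.
have dpoint K k : differentiable
    (fun y => I_elem G M (elem conn x K) (with_point (elem conn xi K) k y))
    (elem conn xi K k).
  apply: (@differentiable_comp _ _ _ _
    (fun y => edge_mx (with_point (elem conn xi K) k y))
    (edge_fun (g K) (edge_mx (elem conn x K)))).
    exact: differentiable_edge_mx_with_point.
  by rewrite with_pointK; exact: dphi.
split=> [K p q|i]; last first.
  apply: (@sderiv_patch_sum _ _ _ _ conn xi i
    (fun K => elem_volume (elem conn x K))
    (fun K => I_elem G M (elem conn x K)) _ dpoint) => K k l kl.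
  by apply: (edge_mx_inj (ux K)); rewrite /elem kl.
have dverticesE : dI_dvertices G M p q =
    sderiv (edge_fun (g K) (edge_mx p)) (edge_mx q).
  exact: sderiv_with_vertex.
split=> //.
- apply: (@differentiable_comp _ _ _ _
    (fun X => edge_mx (with_vertex_mx q X)) (edge_fun (g K) (edge_mx p))).
    exact: differentiable_edge_mx_with_vertex.
  by rewrite with_vertex_mxK; exact: dphi.
- exact: dpoint.
- by rewrite dverticesE (sderiv_edge_fun (uxi K) (dg K)).
- by rewrite dverticesE -(sderiv_with_point0 (dphi K)).
Qed.
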